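(* For all integers $k\ge3$ and $\ell\ge2$, $\widetilde{r}(\sigma_{k,\ell}) \le k^2\ell+15k\ell+2k-12$.
   Context: For integers $k\ge3$ and $\ell\ge2$, the spider $\sigma_{k,\ell}$ is the tree formed as the union of $k$ paths, each of length $\ell$ (i.e. $\ell$ edges), that share exactly one common endpoint. The online Ramsey game for a target graph $H$ is played between Builder and Painter on an infinite set of vertices, initially with no edges. In each round Builder adds a new edge between two vertices (forming the background graph $G$), and Painter immediately colors that edge red or blue. The online Ramsey number $\widetilde{r}(H)$ is the minimum number $m$ such that Builder has a strategy guaranteeing that, against any Painter strategy, after at most $m$ rounds $G$ contains a monochromatic (not necessarily induced) subgraph isomorphic to $H$. *)

(* Defs.v *)
From mathcomp Require Import all_boot.
Set Implicit Arguments.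
Unset Strict Implicit.
Unset Printing Implicit Defensive.

Record sgraph := SGraph {
  svertex :> finType;
  sedge : rel svertex;
  sedge_sym : symmetric sedge;
  sedge_irrefl : irreflexive sedge }.

(* [None] is the common endpoint of the legs; [Some (i, j)] is the vertex at
   distance [j.+1] from it on the i-th leg. *)
Definition spider_rel (k l : nat) (u v : option ('I_k * 'I_l)) : bool :=
  match u, v with
  | None, None => false
  | None, Some (_, j) => j == 0 :> nat
  | Some (_, j), None => j == 0 :> nat
  | Some (i, j), Some (i', j') =>
      (i == i') && ((j.+1 == j' :> nat) || (j'.+1 == j :> nat))
  end.

Lemma spider_rel_sym (k l : nat) : symmetric (@spider_rel k l).
Proof.
by move=> [[i j]|] [[i' j']|] //=; rewrite eq_sym orbC.
Qed.

Lemma spider_rel_irrefl (k l : nat) : irreflexive (@spider_rel k l).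
Proof. by move=> [[i j]|] //=; rewrite eqxx orbb gtn_eqF. Qed.

Definition spider (k l : nat) : sgraph :=
  SGraph (@spider_rel_sym k l) (@spider_rel_irrefl k l).

(* The board has vertex set [nat].  A history lists the coloured edges, most
   recent first; [(x, y)] and [(y, x)] stand for the same edge. *)
Definition color := bool.
Definition history := seq (nat * nat * color).

Definition colored (h : history) (c : color) (x y : nat) : bool :=
  ((x, y, c) \in h) || ((y, x, c) \in h).

Definition new_edge (h : history) (e : nat * nat) : Prop :=
  e.1 <> e.2 /\ forall c : color, ~~ colored h c e.1 e.2.

Definition builder := history -> nat * nat.
Definition painter := history -> nat * nat -> color.

(* Some new edge is available after every history, so asking for a legal move
   also after unreachable histories does not restrict Builder. *)
Definition legal_builder (B : builder) : Prop :=
  forall h : history, new_edge h (B h).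

Fixpoint play (B : builder) (P : painter) (n : nat) : history :=
  if n is n'.+1 then
    let h := play B P n' in (B h, P h (B h)) :: h
  else [::].

Definition mono_copy (H : sgraph) (h : history) : Prop :=
  exists (c : color) (f : H -> nat),
    injective f /\ forall u v : H, sedge u v -> colored h c (f u) (f v).

Definition builder_wins_within (H : sgraph) (m : nat) : Prop :=
  exists B : builder, legal_builder B /\
    forall P : painter, exists n : nat, n <= m /\ mono_copy H (play B P n).

Definition is_online_ramsey_number (H : sgraph) (r : nat) : Prop :=
  builder_wins_within H r /\
  forall m : nat, builder_wins_within H m -> r <= m.

(* Main.v *)
(** Builder first forces a monochromatic, say red, path [s] with about [3kl] vertices.
    A vertex outside [s] with [k] red neighbours whose positions on [s] agree modulo
    [l] is the centre of a red spider, the legs being pieces of [s]; hence every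
    vertex outside [s] has fewer than [k] red edges to each residue class.

    Builder then grows a blue spider whose legs alternate between [s] and new
    vertices.  Let [T] be [2k - 1] unused vertices of one residue class, all joined to
    the centre and to the tip of the current leg.  He joins a new vertex [w] to [T] and
    to one further vertex [x] of the class: as the tip and [w] together have at most
    [2k - 2] red edges to [T], some [v] in [T] is blue to both, the leg grows by [v]
    and [w], and [T - v + x] takes the role of [T].  This costs [k] rounds per vertex
    of the spider, and one more round per step joins the centre to [x], so that a new
    leg can start at any time.  A class of [3k - 1] vertices serves for [k] steps, and
    [2(2k - 1)] rounds introduce it. *)

Require Import Defs.
From mathcomp Require Import all_boot.
From mathcomp Require Import boolp.
From mathcomp Require Import zify.
Set Implicit Arguments.
Unset Strict Implicit.
Unset Printing Implicit Defensive.

Implicit Types (h : history) (c d : color) (W : history -> Prop).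
Implicit Types (p q s : seq nat) (L : seq (seq nat)).

Lemma neq_eq_negb (b b' : bool) : b != b' -> b = ~~ b'.
Proof. by case: b b' => [] []. Qed.

Lemma path_rev_rcons (A : Type) (e : rel A) (x y : A) (p : seq A) :
  symmetric e -> path e x (rcons p y) = path e y (rcons (rev p) x).
Proof.
move=> sym_e; have := rev_path e x (rcons p y).
rewrite belast_rcons last_rcons rev_cons => ->.
by apply: eq_path => a b; rewrite sym_e.
Qed.

Lemma exists_outside_both (A : eqType) (P Q : pred A) (s : seq A) (m n : nat) :
  count P s < m -> count Q s < n -> m + n <= (size s).+1 ->
  exists2 x, x \in s & ~~ P x /\ ~~ Q x.
Proof.
move=> lt_Pm lt_Qn le_mn; have /allPn[x x_s] : ~~ all (predU P Q) s.
  by rewrite all_count; have := count_predUI P Q s; lia.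
by rewrite negb_or => /andP[]; exists x.
Qed.

Lemma exists_notin s : exists x, x \notin s.
Proof.
exists (\max_(y <- s) y).+1; apply/negP => max_s.
by have := @leq_bigmax_seq _ s xpredT id _ max_s isT; rewrite ltnn.
Qed.

Lemma colored_sym h c : symmetric (colored h c).
Proof. by move=> x y; rewrite /colored orbC. Qed.

Lemma colored_subset h h' c (x y : nat) :
  {subset h <= h'} -> colored h c x y -> colored h' c x y.
Proof. by move=> h_h' /orP[] /h_h' xy; rewrite /colored xy ?orbT. Qed.

Lemma path_colored_subset h h' c (x : nat) p :
  {subset h <= h'} -> path (colored h c) x p -> path (colored h' c) x p.
Proof. by move=> h_h'; apply: sub_path => y z; apply: colored_subset. Qed.

Definition revealed h (x y : nat) : bool := [exists c : color, colored h c x y].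

Lemma revealed_subset h h' (x y : nat) :
  {subset h <= h'} -> revealed h x y -> revealed h' x y.
Proof.
by move=> h_h' /existsP[c xy]; apply/existsP; exists c; apply: colored_subset xy.
Qed.

Lemma revealed_colored_negb h c (x y : nat) :
  revealed h x y -> ~~ colored h c x y -> colored h (~~ c) x y.
Proof.
case/existsP=> d xy nxy; suff <- : d = ~~ c by [].
by apply: neq_eq_negb; apply: contraNneq nxy => <-.
Qed.

Lemma exists_new_edge h : exists e, new_edge h e.
Proof.
have [x] := exists_notin (0 :: unzip1 (unzip1 h) ++ unzip2 (unzip1 h)).
rewrite in_cons mem_cat !negb_or => /and3P[x_neq0 x_notin1 x_notin2].
exists (0, x); split=> [/esym/eqP|c]; first exact/negP.
rewrite negb_or; apply/andP; split.
  by apply: contra x_notin2 => /(map_f fst)/(map_f snd).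
by apply: contra x_notin1 => /(map_f fst)/(map_f fst).
Qed.

(** * The game *)

Fixpoint forces W (m : nat) h : Prop :=
  if m is m'.+1 then
    W h \/ exists2 e, new_edge h e & forall c, forces W m' ((e, c) :: h)
  else W h.

Lemma forces_now W (m : nat) h : W h -> forces W m h.
Proof. by case: m => //= m; left. Qed.

Lemma forces_leq W (m m' : nat) h : m <= m' -> forces W m h -> forces W m' h.
Proof.
elim: m m' h => [|m IH] [|m'] h //= le_mm'; first by left.
by case=> [|[e new_e force_e]]; [left | right; exists e => // c; apply: IH].
Qed.

Lemma forces_bind W W' (m n : nat) h :
  forces W m h ->
  (forall h', {subset h <= h'} -> W h' -> forces W' n h') ->
  forces W' (m + n) h.
Proof.
elim: m h => [|m IH] h; first by move=> Wh; apply.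
case=> [Wh W_W'|[e new_e force_e] W_W'].
  by apply: forces_leq (leq_addl _ _) _; apply: W_W'.
right; exists e => // c; apply: IH (force_e c) _ => h' h_h'; apply: W_W' => z z_h.
by apply: h_h'; rewrite in_cons z_h orbT.
Qed.

Lemma forces_weaken W W' (m : nat) h :
  forces W m h -> (forall h', {subset h <= h'} -> W h' -> W' h') -> forces W' m h.
Proof. by move=> force_W; rewrite -[m]addn0; apply: (forces_bind (n := 0) force_W). Qed.

Lemma exists_best_move W h :
  exists e, new_edge h e /\
    forall m, forces W m.+1 h -> W h \/ forall c, forces W m ((e, c) :: h).
Proof.
pose wins m := `[< forces W m.+1 h >].
have [ex_m|no_m] := pselect (exists m, wins m); last first.
  have [e new_e] := exists_new_edge h; exists e; split=> // m force_W.
  by case: no_m; exists m; apply/asboolP.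
case: (ex_minnP ex_m) => m /asboolP[Wh|[e new_e force_e]] min_m.
  by have [e new_e] := exists_new_edge h; exists e; split=> // *; left.
exists e; split=> // m' /asboolP/min_m le_mm'; right=> c.
exact: forces_leq le_mm' (force_e c).
Qed.

Lemma forces_builder_wins (H : sgraph) (m : nat) :
  forces (mono_copy H) m [::] -> builder_wins_within H m.
Proof.
have [B best] := choice (exists_best_move (mono_copy H)).
move=> force_H; exists B; split=> [h|P]; first by case: (best h).
have win (n t : nat) : forces (mono_copy H) t (play B P n) ->
    exists n', n' <= n + t /\ mono_copy H (play B P n').
  elim: t n => [|t IH] n force_n; first by exists n; rewrite addn0.
  have [_ /(_ _ force_n)[copy|force_nS]] := best (play B P n).
    by exists n; rewrite leq_addr.
  by rewrite addnS -addSn; apply: IH; apply: force_nS.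
exact: (win 0).
Qed.

Lemma online_ramsey_number_exists (H : sgraph) (m : nat) :
  builder_wins_within H m -> exists r, is_online_ramsey_number H r /\ r <= m.
Proof.
pose wins r := `[< builder_wins_within H r >].
move=> /asboolP win_m; have ex_r : exists r, wins r by exists m.
case: (ex_minnP ex_r) => r /asboolP win_r min_r.
by exists r; split; [split=> // m' /asboolP/min_r | apply: min_r].
Qed.

(* An edge that has already been drawn costs no round, so Builder may ask for
   the colour of any pair of distinct vertices. *)
Lemma forces_revealed h (x y : nat) :
  x != y -> forces (fun h' => revealed h' x y) 1 h.
Proof.
move=> neq_xy; have [xy_h|/existsPn xy_nh] := boolP (revealed h x y).
  exact: forces_now.
right; exists (x, y) => [|c]; first by split=> //; apply/eqP.
by apply/existsP; exists c; rewrite /colored mem_head.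
Qed.

Lemma forces_all_revealed h (x : nat) (ys : seq nat) :
  x \notin ys -> forces (fun h' => all (revealed h' x) ys) (size ys) h.
Proof.
elim: ys h => [|y ys IH] h; first by move=> _; apply: forces_now.
rewrite in_cons negb_or => /andP[neq_xy x_ys].
apply: (forces_bind (forces_revealed h neq_xy)) => h1 _ xy_h1.
apply: (forces_weaken (IH h1 x_ys)) => h2 h1_h2 ys_h2.
by rewrite /= (revealed_subset h1_h2 xy_h1).
Qed.

(** * Monochromatic paths *)

Definition two_colored_path h (n : nat) : Prop :=
  exists c j p q,
    [/\ uniq (j :: p ++ q), path (colored h c) j p, path (colored h (~~ c)) j q
      & size p + size q = n].

Definition two_colored_cycle h c (j b : nat) p q : Prop :=
  [/\ uniq [:: j, b & p ++ q], path (colored h c) b (rcons p j)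
    & path (colored h (~~ c)) b (rcons q j)].

Lemma two_colored_cycleC h c (j b : nat) p q :
  two_colored_cycle h c j b p q -> two_colored_cycle h (~~ c) j b q p.
Proof.
move=> [uniq_pq path_p path_q]; split; rewrite ?negbK //.
by rewrite (@perm_uniq _ _ [:: j, b & p ++ q]) // !perm_cons perm_catC.
Qed.

(* Whatever its colour, the pendant edge at [j] extends one of the two arcs that
   end in [j]; the other arc loses its last edge. *)
Lemma two_colored_cycle_pendant h c d (j b z : nat) p q :
  two_colored_cycle h c j b p q -> z \notin [:: j, b & p ++ q] ->
  colored h d j z -> two_colored_path h (size p + size q).+2.
Proof.
move=> + + jz; wlog edc : c p q / d = c => [wlog_dc cyc z_fresh|].
  have [edc|/neq_eq_negb edc] := eqVneq d c; first exact: wlog_dc cyc z_fresh.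
  rewrite addnC; apply: wlog_dc edc (two_colored_cycleC cyc) _.
  by apply: contra z_fresh; rewrite !in_cons !mem_cat [(z \in q) || _]orbC.
rewrite edc in jz; move=> [uniq_pq path_p path_q] z_fresh.
exists c, b, (rcons (rcons p j) z), q; split.
- rewrite (@perm_uniq _ _ (z :: [:: j, b & p ++ q])) ?cons_uniq ?z_fresh //.
  by apply/permP => a; rewrite -!cats1 /= !count_cat /=; lia.
- by rewrite rcons_path path_p last_rcons.
- by move: path_q; rewrite rcons_path => /andP[].
- by rewrite !size_rcons.
Qed.

Lemma path_pendant_two_colored h c d (j z : nat) p :
  uniq (j :: p) -> path (colored h c) j p -> z \notin j :: p -> colored h d j z ->
  two_colored_path h (size p).+1.
Proof.
move=> uniq_p path_p z_fresh; have [->|/neq_eq_negb ->] := eqVneq d c => jz.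
  exists c, z, (j :: p), [::].
  by rewrite cats0 addn0 cons_uniq z_fresh uniq_p /= colored_sym jz.
exists c, j, p, [:: z].
by rewrite -cat_cons cats1 rcons_uniq z_fresh uniq_p addn1 /= jz.
Qed.

Lemma perm_two_colored_close (A : eqType) (j a b : A) (p q : seq A) :
  perm_eq [:: j, b & (a :: rev p) ++ rev q] (j :: rcons p a ++ rcons q b).
Proof.
by apply/permP => P; rewrite -!cats1 /= !count_cat !count_rev /=; lia.
Qed.

Lemma two_colored_path_close h c (j a b : nat) p q :
  uniq (j :: rcons p a ++ rcons q b) -> path (colored h c) j (rcons p a) ->
  path (colored h (~~ c)) j (rcons q b) -> colored h c a b ->
  two_colored_cycle h c j b (a :: rev p) (rev q).
Proof.
have sym d := @colored_sym h d.
rewrite (path_rev_rcons j a _ (sym c)) (path_rev_rcons j b _ (sym (~~ c))).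
move=> uniq_pq path_p path_q ab.
split=> //; last by rewrite rcons_cons /= colored_sym ab.
by rewrite (perm_uniq (perm_two_colored_close _ _ _ _ _)).
Qed.

Lemma two_colored_path_reopen h c d d' (j a b z : nat) p q :
  uniq (j :: rcons p a ++ rcons q b) -> path (colored h c) j (rcons p a) ->
  path (colored h (~~ c)) j (rcons q b) -> z \notin j :: rcons p a ++ rcons q b ->
  colored h d a b -> colored h d' j z -> two_colored_path h (size p + size q).+3.
Proof.
move=> + + + + + jz; wlog edc : c p a q b / d = c => [wlog_dc|].
  have [edc|/neq_eq_negb edc] := eqVneq d c; first exact: wlog_dc.
  have swap : perm_eq (j :: rcons p a ++ rcons q b) (j :: rcons q b ++ rcons p a).
    by rewrite perm_cons perm_catC.
  rewrite (perm_uniq swap) (perm_mem swap) colored_sym addnC => uniq_pq path_p path_q.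
  by apply: wlog_dc edc uniq_pq path_q _; rewrite negbK.
rewrite edc => uniq_pq path_p path_q z_fresh ab.
have cyc := two_colored_path_close uniq_pq path_p path_q ab.
have := two_colored_cycle_pendant cyc _ jz; rewrite /= !size_rev addSn; apply.
by rewrite (perm_mem (perm_two_colored_close _ _ _ _ _)).
Qed.

Lemma forces_two_colored_path_step (n : nat) h :
  two_colored_path h n -> forces (two_colored_path^~ n.+1) 2 h.
Proof.
move=> [c [j [p [q [uniq_pq path_p path_q size_pq]]]]].
have [z z_fresh] := exists_notin (j :: p ++ q).
have neq_jz : j != z.
  by rewrite eq_sym; move: z_fresh; rewrite in_cons negb_or => /andP[].
have one_colored c' p' : uniq (j :: p') -> path (colored h c') j p' ->
    z \notin j :: p' -> size p' = n -> forces (two_colored_path^~ n.+1) 2 h.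
  move=> uniq_p' path_p' z_p' <-; apply: (@forces_leq _ 1) => //.
  apply: (forces_weaken (forces_revealed h neq_jz)) => h' h_h' /existsP[d jz].
  exact: path_pendant_two_colored uniq_p' (path_colored_subset h_h' path_p') z_p' jz.
case/lastP: p => [|p a] in uniq_pq path_p size_pq z_fresh *.
  exact: one_colored uniq_pq path_q z_fresh size_pq.
case/lastP: q => [|q b] in uniq_pq path_q size_pq z_fresh *.
  rewrite cats0 addn0 in uniq_pq size_pq z_fresh.
  exact: one_colored uniq_pq path_p z_fresh size_pq.
have neq_ab : a != b.
  move: uniq_pq; rewrite cons_uniq cat_uniq => /and4P[_ _ /hasPn/(_ b) + _].
  by rewrite !mem_rcons !mem_head in_cons negb_or eq_sym => /(_ isT)/andP[].
apply: (forces_bind (m := 1) (forces_revealed h neq_ab)) => h1 h_h1 /existsP[d ab].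
apply: (forces_weaken (forces_revealed h1 neq_jz)) => h2 h1_h2 /existsP[d' jz].
have h_h2 : {subset h <= h2} by move=> e /h_h1/h1_h2.
rewrite -size_pq !size_rcons addSn addnS.
apply: two_colored_path_reopen uniq_pq _ _ z_fresh (colored_subset h1_h2 ab) jz.
  exact: path_colored_subset h_h2 path_p.
exact: path_colored_subset h_h2 path_q.
Qed.

Lemma forces_two_colored_path (n : nat) h :
  forces (two_colored_path^~ n) (2 * n) h.
Proof.
elim: n => [|n IH]; first by exists true, 0, [::], [::].
rewrite mulnS addnC; apply: (forces_bind IH) => h' _.
exact: forces_two_colored_path_step.
Qed.

Definition mono_path h (n : nat) : Prop :=
  exists c s, [/\ uniq s, sorted (colored h c) s & n <= size s].

Lemma two_colored_path_mono h (n : nat) :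
  two_colored_path h (2 * n) -> mono_path h n.+1.
Proof.
move=> [c [j [p [q [uniq_pq path_p path_q size_pq]]]]].
have [le_np|lt_pn] := leqP n (size p).
  exists c, (j :: p); split=> //.
  by move: uniq_pq; rewrite -cat_cons cat_uniq => /andP[].
exists (~~ c), (j :: q); split=> //; last by rewrite /=; lia.
by apply: subseq_uniq uniq_pq; rewrite /= eqxx suffix_subseq.
Qed.

Lemma forces_mono_path (n : nat) h : forces (mono_path^~ n) (4 * n.-1) h.
Proof.
case: n => [|n]; first by exists true, [::].
have -> : 4 * n.+1.-1 = 2 * (2 * n) by rewrite /= mulnA.
apply: (forces_weaken (forces_two_colored_path (2 * n) h)) => h' _.
exact: two_colored_path_mono.
Qed.

(** * Spiders *)

Definition spider_legs h c (l u : nat) L : bool :=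
  all (fun p => (size p == l) && path (colored h c) u p) L.

Lemma size_flatten_spider_legs h c (l u : nat) L :
  spider_legs h c l u L -> size (flatten L) = l * size L.
Proof.
elim: L => [|p L IH] /=; first by rewrite muln0.
by case/andP=> /andP[/eqP size_p _] /IH size_L; rewrite size_cat size_p size_L mulnS.
Qed.

Lemma mono_copy_spider h c (k l u : nat) L :
  uniq (u :: flatten L) -> spider_legs h c l u L -> k <= size L ->
  mono_copy (spider k l) h.
Proof.
rewrite cons_uniq => /andP[u_L uniq_L] /allP legs le_kL.
have legP (i : 'I_k) :
    size (nth [::] L i) = l /\ path (colored h c) u (nth [::] L i).
  have lt_iL : i < size L by apply: leq_trans le_kL.
  by have /andP[/eqP] := legs _ (mem_nth [::] lt_iL).
pose pos (i : 'I_k) (j : 'I_l) := flatten_index (shape L) i j.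
have in_leg (i : 'I_k) (j : 'I_l) : j < nth 0 (shape L) i.
  by rewrite nth_shape (legP i).1.
have vertexE (i : 'I_k) (j : 'I_l) :
    nth 0 (nth [::] L i) j = nth 0 (flatten L) (pos i j).
  by rewrite nth_flatten flatten_indexKl ?flatten_indexKr.
have pos_lt i j : pos i j < size (flatten L) by rewrite size_flatten flatten_indexP.
pose vertex (v : option ('I_k * 'I_l)) :=
  if v is Some (i, j) then nth 0 (nth [::] L i) j else u.
exists c, vertex; split=> [[[i j]|] [[i' j']|] //= | [[i j]|] [[i' j']|] //=].
- rewrite !vertexE => /eqP; rewrite nth_uniq // => /eqP eq_pos.
  have := congr1 (reshape_offset (shape L)) eq_pos.
  have := congr1 (reshape_index (shape L)) eq_pos.
  rewrite !flatten_indexKl ?flatten_indexKr // => eq_i eq_j.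
  by congr (Some (_, _)); apply: val_inj.
- by rewrite vertexE => eq_u; case/negP: u_L; rewrite -eq_u mem_nth.
- by rewrite vertexE => eq_u; case/negP: u_L; rewrite eq_u mem_nth.
- have [size_leg /(pathP 0) leg_path] := legP i.
  case/andP=> /eqP <- /orP[] /eqP eq_j; rewrite -eq_j; last rewrite colored_sym.
    by apply: (leg_path j.+1); rewrite size_leg eq_j.
  by apply: (leg_path j'.+1); rewrite size_leg eq_j.
- have [size_leg /(pathP 0) leg_path] := legP i.
  move/eqP=> eq_j; rewrite colored_sym eq_j.
  by apply: (leg_path 0); rewrite size_leg -eq_j.
- have [size_leg /(pathP 0) leg_path] := legP i'.
  move/eqP=> eq_j; rewrite eq_j.
  by apply: (leg_path 0); rewrite size_leg -eq_j.
Qed.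

Lemma addn_muln_inj (l r i r' i' : nat) :
  r < l -> r' < l -> r + l * i = r' + l * i' -> r = r' /\ i = i'.
Proof.
rewrite ![_ + l * _]addnC ![l * _]mulnC => lt_rl lt_r'l eq_pos.
have l_gt0 : 0 < l by apply: leq_ltn_trans lt_rl.
move: (congr1 (modn^~ l) eq_pos) (congr1 (divn^~ l) eq_pos).
by rewrite !modnMDl !divnMDl // !modn_small // !divn_small // !addn0.
Qed.

Section Pieces.

Variables (A : eqType) (x0 : A) (l : nat) (s : seq A).
Hypothesis uniq_s : uniq s.

Definition piece (x : A) : seq A := take l (drop (index x s) s).

(* Vertices whose positions agree modulo [l] start disjoint pieces. *)
Definition piece_start (r : nat) (x : A) : bool :=
  (index x s + l <= size s) && (index x s %% l == r).

Definition residue_class (m r : nat) : seq A :=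
  [seq nth x0 s (r + l * i) | i <- iota 0 m].

Lemma mem_piece (x : A) : {subset piece x <= s}.
Proof. by move=> y /mem_take/mem_drop. Qed.

Lemma mem_piece_start (r : nat) (x : A) : 0 < l -> piece_start r x -> x \in s.
Proof.
move=> l_gt0 /andP[x_s _]; rewrite -index_mem; apply: leq_trans x_s.
by rewrite -[X in X < _]addn0 ltn_add2l.
Qed.

Lemma pieceE (r : nat) (x : A) : piece_start r x ->
  piece x = [seq nth x0 s (index x s + j) | j <- iota 0 l].
Proof.
move=> /andP[x_s _]; rewrite /piece -(@map_nth_iota _ x0); last first.
  by rewrite leq_subRL ?(leq_trans (leq_addr _ _) x_s).
by rewrite -[index x s in LHS]addn0 iotaDl -map_comp.
Qed.

Lemma uniq_flatten_pieces (r : nat) (X : seq A) :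
  uniq X -> all (piece_start r) X -> uniq (flatten [seq piece x | x <- X]).
Proof.
move=> uniq_X /allP starts.
have -> : [seq piece x | x <- X] =
    [seq [seq nth x0 s (index x s + j) | j <- iota 0 l] | x <- X].
  by apply/eq_in_map => x /starts/pieceE.
apply: allpairs_uniq => //; first exact: iota_uniq.
move=> _ _ /allpairsP[[x j] /= [x_X + ->]] /allpairsP[[y i] /= [y_X + ->]] /= /eqP.
rewrite !mem_iota !add0n => lt_jl lt_il.
have /andP[x_s /eqP x_r] := starts _ x_X; have /andP[y_s /eqP y_r] := starts _ y_X.
have pos_lt z a : a < l -> index z s + l <= size s -> index z s + a < size s.
  by move=> lt_al; apply: leq_trans; rewrite ltn_add2l.
rewrite nth_uniq ?pos_lt // => /eqP eq_pos.
have eq_ij : i = j.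
  have := congr1 (modn^~ l) eq_pos; rewrite -modnDml x_r -[in RHS]modnDml y_r.
  by move/eqP; rewrite eqn_modDl !modn_small // => /eqP.
move/eqP: eq_pos; rewrite eq_ij eqn_add2r => /eqP eq_index; congr (_, _).
have l_gt0 : 0 < l by apply: leq_ltn_trans lt_jl.
by apply: (index_inj x0) eq_index; apply: mem_piece_start; do ?apply: starts.
Qed.

Lemma residue_class_room (m r i : nat) :
  i < m -> r + l * m <= size s -> r + l * i + l <= size s.
Proof.
move=> lt_im; apply: leq_trans.
by rewrite -addnA leq_add2l -mulnSr leq_mul2l lt_im orbT.
Qed.

Lemma residue_class_start (m r : nat) :
  r < l -> r + l * m <= size s -> all (piece_start r) (residue_class m r).
Proof.
move=> lt_rl room; apply/allP => _ /mapP[i + ->]; rewrite mem_iota add0n => lt_im.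
have fits := residue_class_room lt_im room.
rewrite /piece_start index_uniq ?fits //; last by apply: leq_trans fits; lia.
by rewrite andTb addnC mulnC modnMDl modn_small.
Qed.

Lemma uniq_residue_classes (m n : nat) :
  n <= l -> l * m + n.-1 <= size s ->
  uniq (flatten [seq residue_class m r | r <- iota 0 n]).
Proof.
move=> le_nl room; apply: allpairs_uniq; try exact: iota_uniq.
move=> _ _ /allpairsP[[r i] /= [+ + ->]] /allpairsP[[r' i'] /= [+ + ->]] /= /eqP.
rewrite !mem_iota !add0n => lt_rn lt_im lt_r'n lt_i'm.
have fits a b : a < n -> b < m -> a + l * b < size s.
  move=> lt_an lt_bm; have room_a : a + l * m <= size s by lia.
  by apply: leq_trans (residue_class_room lt_bm room_a); lia.
rewrite nth_uniq ?fits // => /eqP.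
by case/addn_muln_inj=> [||-> ->] //; lia.
Qed.

End Pieces.

Lemma path_piece h c (l r u x : nat) s :
  0 < l -> sorted (colored h c) s -> piece_start l s r x -> colored h c u x ->
  (size (piece l s x) == l) && path (colored h c) u (piece l s x).
Proof.
move=> l_gt0 path_s start_x ux; rewrite {1}(pieceE 0 start_x) size_map size_iota eqxx.
have : sorted (colored h c) (piece l s x) by apply/take_sorted/drop_sorted.
rewrite /piece (drop_index (mem_piece_start l_gt0 start_x)) -(prednK l_gt0) /=.
by rewrite ux.
Qed.

Lemma mono_copy_spider_pieces h c (k l r u : nat) s (X : seq nat) :
  0 < l -> uniq s -> sorted (colored h c) s -> u \notin s ->
  uniq X -> all (piece_start l s r) X -> all (colored h c u) X -> k <= size X ->
  mono_copy (spider k l) h.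
Proof.
move=> l_gt0 uniq_s path_s u_s uniq_X starts ux le_kX.
apply: (@mono_copy_spider _ c _ _ u [seq piece l s x | x <- X]).
- rewrite cons_uniq (uniq_flatten_pieces 0 uniq_s uniq_X starts) andbT.
  by apply: contra u_s => /flatten_mapP[x _]; apply: mem_piece.
- rewrite /spider_legs all_map; apply/allP => x x_X.
  exact: path_piece path_s (allP starts x x_X) (allP ux x x_X).
- by rewrite size_map.
Qed.

Lemma mono_copy_or_count_colored h c (k l r u : nat) s (X : seq nat) :
  0 < l -> uniq s -> sorted (colored h c) s -> u \notin s ->
  uniq X -> all (piece_start l s r) X ->
  mono_copy (spider k l) h \/ count (colored h c u) X < k.
Proof.
move=> l_gt0 uniq_s path_s u_s uniq_X starts.
have [le_k|lt_k] := leqP k (count (colored h c u) X); [left | by right].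
pose Y := filter (colored h c u) X.
apply: (@mono_copy_spider_pieces _ c _ _ r u s Y) => //.
- exact: filter_uniq.
- by apply/allP => x; rewrite mem_filter => /andP[_ /(allP starts _)].
- exact: filter_all.
- by rewrite size_filter.
Qed.

(** * Growth of the blue spider *)

(* The legs in [L] are complete; [p] is the leg under construction. *)
Definition partial_spider h c (l u : nat) L p : Prop :=
  [/\ spider_legs h c l u L, path (colored h c) u p, ~~ odd (size p) & size p < l].

(* A step adds two vertices to [p], or one if only one is missing. *)
Definition spider_steps (l : nat) L p : nat := uphalf l * size L + (size p)./2.

Definition vertices_left (k l : nat) L p : nat := k * l - size (flatten (p :: L)).

Lemma partial_spider_subset h h' c (l u : nat) L p :
  {subset h <= h'} -> partial_spider h c l u L p -> partial_spider h' c l u L p.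
Proof.
move=> h_h' [legs path_p even_p lt_pl]; split=> //.
  by apply: sub_all legs => q /andP[-> /(path_colored_subset h_h')].
exact: path_colored_subset path_p.
Qed.

Lemma partial_spider_finish h c (l u v : nat) L p :
  partial_spider h c l u L p -> colored h c (last u p) v -> (size p).+1 = l ->
  partial_spider h c l u (rcons p v :: L) [::] /\
  spider_steps l (rcons p v :: L) [::] = (spider_steps l L p).+1.
Proof.
move=> [+ path_p _ _] pv size_p; rewrite -{l}size_p => legs; split.
  by split; rewrite //= size_rcons eqxx rcons_path path_p pv.
by rewrite /spider_steps /= mulnS addn0 addnC addnS.
Qed.

Lemma partial_spider_extend h c (l u v w : nat) L p :
  partial_spider h c l u L p -> colored h c (last u p) v -> colored h c v w ->
  (size p).+1 < l ->
  exists L' p', [/\ partial_spider h c l u L' p', last u p' \in [:: u; w],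
    perm_eq (flatten (p' :: L')) [:: v, w & flatten (p :: L)] &
    spider_steps l L' p' = (spider_steps l L p).+1].
Proof.
move=> [legs path_p even_p _] pv vw lt_pl.
have path_vw : path (colored h c) u (rcons (rcons p v) w).
  by rewrite !rcons_path path_p last_rcons pv.
have perm_vw : perm_eq (rcons (rcons p v) w ++ flatten L) [:: v, w & p ++ flatten L].
  by apply/permP => P; rewrite -!cats1 /= !count_cat /=; lia.
have [eq_pl|neq_pl] := eqVneq (size p).+2 l.
  exists (rcons (rcons p v) w :: L), [::]; split=> //.
  - by split; rewrite /= ?size_rcons ?eq_pl ?eqxx ?path_vw // (ltn_trans _ lt_pl).
  - exact: mem_head.
  - by rewrite /spider_steps /= -eq_pl uphalf_half /= (negPf even_p); lia.
exists L, (rcons (rcons p v) w); split=> //.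
- by split; rewrite ?size_rcons //= ?negbK // ltn_neqAle neq_pl.
- by rewrite last_rcons !inE eqxx orbT.
- by rewrite /spider_steps !size_rcons /= addnS.
Qed.

Lemma leq_size_spider_steps h c (k l u : nat) L p :
  partial_spider h c l u L p -> uphalf l * k <= spider_steps l L p -> k <= size L.
Proof.
move=> [_ _ even_p lt_pl] le_k; rewrite leqNgt; apply/negP => lt_Lk.
have : uphalf l * (size L).+1 <= uphalf l * k by rewrite leq_mul2l lt_Lk orbT.
by move: le_k; rewrite /spider_steps mulnS; lia.
Qed.

Lemma leq_vertices_left h c (k l u n : nat) L p :
  spider_legs h c l u L -> size L < k -> size p + n <= l ->
  n <= vertices_left k l L p.
Proof.
move=> legs lt_Lk le_pl; have le_legs : l * size L + l <= k * l.
  by rewrite -mulnSr mulnC leq_mul2r lt_Lk orbT.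
by rewrite /vertices_left /= size_cat (size_flatten_spider_legs legs); lia.
Qed.

Lemma perm_exchange (A : eqType) (a v x : A) (ws F F' T T' Q : seq A) :
  perm_eq F' (v :: ws ++ F) -> perm_eq T (v :: T') ->
  perm_eq (a :: F' ++ (x :: T') ++ Q) (ws ++ a :: F ++ T ++ x :: Q).
Proof.
move=> /permP perm_F /permP perm_T; apply/permP => P; move: (perm_F P) (perm_T P).
by rewrite /= !count_cat /= !count_cat /=; lia.
Qed.

Section Growth.

Variables (k l : nat) (c : color) (s : seq nat) (u0 : nat).
Hypotheses (k_gt0 : 0 < k) (l_gt0 : 0 < l) (uniq_s : uniq s) (u0_s : u0 \notin s).
Implicit Types (r x v : nat) (T R P : seq nat).

Definition spider_state h L p P : Prop :=
  [/\ sorted (colored h c) s, partial_spider h (~~ c) l u0 L p, last u0 p \notin s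
    & uniq (u0 :: flatten (p :: L) ++ P)].

(* The next vertex of the blue spider is taken from [T], which is replenished from
   [R]; both belong to the same residue class, and [P] to the classes to come. *)
Definition class_state h r L p T R P : Prop :=
  [/\ spider_state h L p (T ++ R ++ P), (size T).+1 = 2 * k,
      all (piece_start l s r) (T ++ R), all (revealed h u0) T
    & all (revealed h (last u0 p)) T].

Definition class_advanced r (n : nat) L p R P h : Prop :=
  mono_copy (spider k l) h \/
  exists L' p' T', [/\ class_state h r L' p' T' R P,
    size (flatten (p' :: L')) = n + size (flatten (p :: L)) &
    spider_steps l L' p' = (spider_steps l L p).+1].

Lemma spider_state_subset h h' L p P :
  {subset h <= h'} -> spider_state h L p P -> spider_state h' L p P.
Proof.
move=> h_h' [path_s spider_p tip_s uniq_P]; split=> //.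
  by apply: sub_sorted path_s => x y; apply: colored_subset.
exact: partial_spider_subset spider_p.
Qed.

Lemma class_state_subset h h' r L p T R P :
  {subset h <= h'} -> class_state h r L p T R P -> class_state h' r L p T R P.
Proof.
move=> h_h' [spider_p size_T starts center tip]; split=> //.
- exact: spider_state_subset spider_p.
- by apply: sub_all center => x; apply: revealed_subset.
- by apply: sub_all tip => x; apply: revealed_subset.
Qed.

Lemma spider_state_complete h L p P :
  spider_state h L p P -> k <= size L -> mono_copy (spider k l) h.
Proof.
move=> [_ [legs _ _ _] _ uniq_state]; apply: mono_copy_spider legs.
apply: subseq_uniq uniq_state; rewrite /= eqxx.
by apply: subseq_trans (prefix_subseq _ P); apply: suffix_subseq.
Qed.

Lemma mono_copy_or_count_class h r (u : nat) L p T R P :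
  class_state h r L p T R P -> u \notin s ->
  mono_copy (spider k l) h \/ count (colored h c u) T < k.
Proof.
move=> [[path_s _ _ uniq_P] _ starts _ _] u_s.
have uniq_T : uniq T by move: uniq_P; rewrite cons_uniq !cat_uniq => /and5P[].
have starts_T : all (piece_start l s r) T by move: starts; rewrite all_cat => /andP[].
exact: mono_copy_or_count_colored l_gt0 uniq_s path_s u_s uniq_T starts_T.
Qed.

Lemma class_state_exchange h r x v L L' p p' T R P (ws : seq nat) :
  class_state h r L p T (x :: R) P -> v \in T -> revealed h u0 x ->
  partial_spider h (~~ c) l u0 L' p' ->
  perm_eq (flatten (p' :: L')) (v :: ws ++ flatten (p :: L)) ->
  uniq (ws ++ u0 :: flatten (p :: L) ++ T ++ x :: R ++ P) ->
  last u0 p' \notin s -> all (revealed h (last u0 p')) (x :: T) ->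
  class_state h r L' p' (x :: rem v T) R P.
Proof.
move=> [[path_s _ _ _] size_T starts center _] v_T u0x spider_p' perm_p' uniq_ws tip_s.
case/andP=> tip_x tip_T; split.
- split=> //.
  rewrite (@perm_uniq _ _ (ws ++ u0 :: flatten (p :: L) ++ T ++ x :: R ++ P)) //.
  exact: perm_exchange perm_p' (perm_to_rem v_T).
- by rewrite /= size_rem // prednK //; case: (T) v_T.
- move: starts; rewrite !all_cat /= => /and3P[/allP starts_T -> ->]; rewrite andbT.
  by apply/allP => y /mem_rem/starts_T.
- by rewrite /= u0x; apply/allP => y /mem_rem/(allP center).
- by rewrite /= tip_x; apply/allP => y /mem_rem/(allP tip_T).
Qed.

Lemma forces_class_state h r L p P (X : seq nat) :
  spider_state h L p (X ++ P) -> all (piece_start l s r) X -> size X = (3 * k).-1 ->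
  forces (fun h' => exists T R, class_state h' r L p T R P /\ size R = k)
    (2 * (2 * k).-1) h.
Proof.
move=> spider_h starts size_X; have [_ _ tip_s _] := spider_h.
set T := take (2 * k).-1 X; pose R := drop (2 * k).-1 X.
have size_T : size T = (2 * k).-1 by rewrite size_takel // size_X; lia.
have T_s y : y \in T -> y \in s.
  by move/mem_take/(allP starts); apply: mem_piece_start.
have center_T := forces_all_revealed h (contra (@T_s _) u0_s).
rewrite mul2n -addnn -{1}size_T; apply: (forces_bind center_T) => h1 h_h1 center.
have tip_T := forces_all_revealed h1 (contra (@T_s _) tip_s).
rewrite -size_T; apply: (forces_weaken tip_T) => h2 h1_h2 tip.
exists T, R; split; last by rewrite size_drop size_X; lia.
split=> //; rewrite ?size_T ?cat_take_drop //.
- by rewrite catA cat_take_drop; apply: spider_state_subset spider_h => e /h_h1/h1_h2.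
- by rewrite prednK // muln_gt0.
- by apply: sub_all center => y; apply: revealed_subset.
Qed.

Lemma forces_center_revealed h r x L p T R P :
  class_state h r L p T (x :: R) P -> forces (fun h' => revealed h' u0 x) 1 h.
Proof.
case=> _ _ /allP starts _ _; apply/forces_revealed/(contraNneq _ u0_s) => ->.
apply: (mem_piece_start (r := r) l_gt0); apply: starts.
by rewrite mem_cat mem_head orbT.
Qed.

Lemma forces_class_extend h r x L p T R P :
  class_state h r L p T (x :: R) P -> (size p).+1 < l ->
  forces (class_advanced r 2 L p R P) (1 + k * 2) h.
Proof.
move=> state_h lt_pl.
apply: (forces_bind (forces_center_revealed state_h)) => h1 h_h1 u0x.
have [w] := exists_notin (s ++ u0 :: flatten (p :: L) ++ T ++ x :: R ++ P).
rewrite mem_cat negb_or => /andP[w_s w_fresh].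
have w_xT : w \notin x :: T.
  by apply: contra w_fresh; rewrite !(inE, mem_cat) => /orP[] ->; rewrite !orbT.
have -> : k * 2 = size (x :: T).
  by have [_ size_T _ _ _] := state_h; rewrite mulnC -size_T.
apply: (forces_weaken (forces_all_revealed h1 w_xT)) => h2 h1_h2 w_all.
have {}u0x := revealed_subset h1_h2 u0x.
have {h_h1}h_h2 : {subset h <= h2} by move=> e /h_h1/h1_h2.
have state_h2 := class_state_subset h_h2 state_h.
have [[_ spider_p tip_s uniq_state] size_T _ center tip] := state_h2.
have [|count_tip] := mono_copy_or_count_class state_h2 tip_s; first by left.
have [|count_w] := mono_copy_or_count_class state_h2 w_s; first by left.
have [|v v_T [tip_v wv]] := exists_outside_both count_tip count_w.
  by rewrite size_T mul2n addnn.
have w_v : revealed h2 w v by apply: (allP w_all); rewrite inE v_T orbT.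
have blue_tip_v := revealed_colored_negb (allP tip v v_T) tip_v.
have blue_w_v := revealed_colored_negb w_v wv; rewrite colored_sym in blue_w_v.
have [L' [p' [spider_p' tip' perm_p' steps_p']]] :=
  partial_spider_extend spider_p blue_tip_v blue_w_v lt_pl.
right; exists L', p', (x :: rem v T); split=> //; last exact: perm_size perm_p'.
apply: (class_state_exchange (ws := [:: w]) state_h2 v_T u0x spider_p' perm_p').
- by rewrite cat_cons cons_uniq w_fresh uniq_state.
- by move: tip'; rewrite !inE => /orP[] /eqP ->.
- by move: tip'; rewrite !inE => /orP[] /eqP -> //=; rewrite u0x.
Qed.

Lemma forces_class_finish h r x L p T R P :
  class_state h r L p T (x :: R) P -> (size p).+1 = l ->
  forces (class_advanced r 1 L p R P) 1 h.
Proof.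
move=> state_h size_p.
apply: (forces_weaken (forces_center_revealed state_h)) => h1 h_h1 u0x.
have state_h1 := class_state_subset h_h1 state_h.
have [[_ spider_p tip_s uniq_state] size_T _ center tip] := state_h1.
have [|count_tip] := mono_copy_or_count_class state_h1 tip_s; first by left.
have /allPn[v v_T tip_v] : ~~ all (colored h1 c (last u0 p)) T.
  rewrite all_count neq_ltn (leq_trans count_tip) // -ltnS size_T.
  by rewrite mul2n -addnn -addn1 leq_add2l.
have blue_tip_v := revealed_colored_negb (allP tip v v_T) tip_v.
have [spider_p' steps_p'] := partial_spider_finish spider_p blue_tip_v size_p.
right; exists (rcons p v :: L), [::], (x :: rem v T); split=> //.
  apply: (class_state_exchange (ws := [::]) state_h1 v_T u0x spider_p') => //=.
    by rewrite -cats1 -catA perm_catCA.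
  by rewrite u0x.
by rewrite /= !size_cat size_rcons.
Qed.

Lemma forces_class_step h r x L p T R P :
  class_state h r L p T (x :: R) P ->
  exists2 n, size p + n <= l & forces (class_advanced r n L p R P) (1 + k * n) h.
Proof.
move=> state_h; have [[_ [_ _ _ lt_pl] _ _] _ _ _ _] := state_h.
have [lt_p1l|le_lp1] := ltnP (size p).+1 l.
  by exists 2; [rewrite addn2 | apply: forces_class_extend state_h lt_p1l].
exists 1; first by rewrite addn1.
apply: forces_leq (leq_addr _ _) _; apply: forces_class_finish state_h _.
by apply/eqP; rewrite eqn_leq lt_pl.
Qed.

Lemma forces_class (m cost r : nat) P :
  (forall h L p, spider_state h L p P -> uphalf l * k <= spider_steps l L p + m ->
    forces (mono_copy (spider k l)) (cost + k * vertices_left k l L p) h) ->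
  forall R h L p T, class_state h r L p T R P ->
    uphalf l * k <= spider_steps l L p + (size R + m) ->
    forces (mono_copy (spider k l)) (size R + cost + k * vertices_left k l L p) h.
Proof.
move=> later_classes; elim=> [|x R IH] h L p T state_h enough.
  case: state_h => -[path_s spider_p tip_s uniq_state] _ _ _ _.
  apply: later_classes enough; split=> //.
  by apply: subseq_uniq uniq_state; rewrite /= eqxx; exact/cat_subseq/suffix_subseq.
have [spider_h _ _ _ _] := state_h; have [_ [legs _ _ _] _ _] := spider_h.
have [le_kL|lt_Lk] := leqP k (size L).
  exact: forces_now (spider_state_complete spider_h le_kL).
have [n le_pl step] := forces_class_step state_h.
have n_left := leq_vertices_left legs lt_Lk le_pl.
rewrite -(subnKC n_left) mulnDr -[size (x :: R)]/(1 + size R) -(addnA 1) addnACA.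
apply: (forces_bind step) => h' _ [copy|[L' [p' [T' [state_h' size_p' steps_p']]]]].
  exact: forces_now.
have <- : vertices_left k l L' p' = vertices_left k l L p - n.
  by rewrite /vertices_left size_p' addnC subnDA.
by apply: IH state_h' _; rewrite steps_p' addSnnS.
Qed.

Lemma forces_classes (rs : seq nat) h L p :
  {in rs, forall r, all (piece_start l s r) (residue_class 0 l s (3 * k).-1 r)} ->
  spider_state h L p (flatten [seq residue_class 0 l s (3 * k).-1 r | r <- rs]) ->
  uphalf l * k <= spider_steps l L p + k * size rs ->
  forces (mono_copy (spider k l))
    (size rs * (5 * k - 2) + k * vertices_left k l L p) h.
Proof.
elim: rs h L p => [|r rs IH] h L p starts spider_h enough.
  rewrite muln0 addn0 in enough; have [_ spider_p _ _] := spider_h.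
  have le_kL := leq_size_spider_steps spider_p enough.
  exact: forces_now (spider_state_complete spider_h le_kL).
have size_class : size (residue_class 0 l s (3 * k).-1 r) = (3 * k).-1.
  by rewrite size_map size_iota.
have refill := forces_class_state spider_h (starts r (mem_head r rs)) size_class.
have -> : size (r :: rs) * (5 * k - 2) + k * vertices_left k l L p =
    2 * (2 * k).-1 + (k + size rs * (5 * k - 2) + k * vertices_left k l L p).
  by rewrite /= mulSn !addnA; congr (_ + _ + _); lia.
apply: (forces_bind refill) => h' _ [T [R [state_h' size_R]]].
rewrite -[X in X + _ + _]size_R.
apply: (@forces_class (k * size rs)) state_h' _ => [h2 L2 p2|].
  by apply: IH => r' r'_rs; apply: starts; rewrite in_cons r'_rs orbT.
by rewrite size_R -mulnS.
Qed.

End Growth.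

Lemma forces_spider_of_path (k l : nat) c s h :
  0 < k -> 0 < l -> uniq s -> sorted (colored h c) s ->
  l * (3 * k).-1 + l./2 <= size s ->
  forces (mono_copy (spider k l)) (uphalf l * (5 * k - 2) + k * (k * l)) h.
Proof.
move=> k_gt0 l_gt0 uniq_s path_s room; have [u0 u0_s] := exists_notin s.
pose rs := iota 0 (uphalf l); have size_rs : size rs = uphalf l by apply: size_iota.
have starts (r : nat) :
    r \in rs -> all (piece_start l s r) (residue_class 0 l s (3 * k).-1 r).
  rewrite mem_iota add0n => lt_r.
  by apply: residue_class_start => //; [|apply: leq_trans room]; lia.
have -> : k * l = vertices_left k l [::] [::] by rewrite /vertices_left subn0.
rewrite -size_rs; apply: (forces_classes (c := c) k_gt0 l_gt0 uniq_s u0_s starts).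
  split=> //=; rewrite uniq_residue_classes ?andbT //;
    [|by lia|by apply: leq_trans room; lia].
  apply: contra u0_s => /flatten_mapP[r /starts/allP start_r /start_r].
  exact: mem_piece_start.
by rewrite size_rs mulnC leq_addl.
Qed.

Lemma round_count_leq (k l : nat) : 2 < k -> 1 < l ->
  4 * (l * (3 * k).-1 + l./2).-1 + (uphalf l * (5 * k - 2) + k * (k * l)) <=
  k ^ 2 * l + 15 * k * l + 2 * k - 12.
Proof.
move=> k_gt2 l_gt1; have [j ->] : exists j, k = j.+3.
  by exists (k - 3); rewrite -addn3 subnK.
have [a half_l] : exists a, l./2 = a.+1 by exists l./2.-1; lia.
have l_eq : l = odd l + 2 * a.+1 by rewrite -half_l mul2n odd_double_half.
rewrite uphalf_half half_l; move: (odd l) l_eq => b ->.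
by case: b; rewrite expnS expn1; nia.
Qed.

Theorem theorem6 (k l : nat) (hk : 3 <= k) (hl : 2 <= l) :
  exists r : nat, is_online_ramsey_number (spider k l) r /\
    r <= k ^ 2 * l + 15 * k * l + 2 * k - 12.
Proof.
apply: online_ramsey_number_exists; apply: forces_builder_wins.
apply: forces_leq (round_count_leq hk hl) _.
apply: (forces_bind (forces_mono_path _ _)) => h _ [c [s [uniq_s path_s long_s]]].
have k_gt0 : 0 < k by apply: leq_trans hk.
exact: forces_spider_of_path k_gt0 (ltnW hl) uniq_s path_s long_s.
Qed.
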